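(* Every contact string graph has a vertex whose neighborhood is the union of $4$ cliques.
   Context: Graphs are finite, simple and have at least one vertex. The neighborhood of a vertex $v$ is the set of vertices adjacent to $v$; cliques are sets of pairwise adjacent vertices, and in ''union of $4$ cliques'' the cliques may overlap or be empty (i.e. the neighborhood induces a subgraph with clique cover number at most $4$). A simple curve (string) in $\mathbb{R}^2$ is a subset of $\mathbb{R}^2$ homeomorphic to $[0,1]$; its interior is the curve minus its two endpoints. A contact string graph is the intersection graph of a finite set of simple curves in $\mathbb{R}^2$ whose interiors are pairwise disjoint (vertices are the curves, two distinct ones adjacent iff they intersect). *)

(* Defs.v *)
From HB Require Import structures.
From mathcomp Require Import all_boot all_order all_algebra.
From mathcomp Require Import all_classical all_reals topology normedtype.

Set Implicit Arguments.
Unset Strict Implicit.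
Unset Printing Implicit Defensive.

Import Order.TTheory GRing.Theory Num.Theory.
Import numFieldNormedType.Exports.

Local Open Scope classical_set_scope.
Local Open Scope ring_scope.

(** Finite graphs are given by their adjacency relation [e : rel V] on a
    finite type [V] of vertices. *)

Definition neighborhood (V : finType) (e : rel V) (v : V) : {set V} :=
  [set u | e v u]%SET.

Definition clique (V : finType) (e : rel V) (K : {set V}) : Prop :=
  {in K &, forall x y, x != y -> e x y}.

(* The cliques [K i] may overlap or be empty. *)
Definition union_of_cliques (V : finType) (e : rel V) (k : nat)
    (N : {set V}) : Prop :=
  exists2 K : 'I_k -> {set V},
    forall i, clique e (K i) & N = (\bigcup_(i < k) K i)%SET.

(* [f] restricts to a homeomorphism from the subspace [A] onto the subspace
   [B], with inverse [g]; the values of [f] outside [A] and of [g] outside [B]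
   are irrelevant. *)
Definition homeomorphism (T U : topologicalType) (A : set T) (B : set U)
    (f : T -> U) (g : U -> T) : Prop :=
  [/\ f @` A = B, {in A, cancel f g},
      {within A, continuous f} & {within B, continuous g}].

(* [C] is a simple curve with endpoints [a] and [b]. The pair of endpoints of a
   simple curve does not depend, up to order, on the homeomorphism. *)
Definition simple_curve (R : realType) (C : set (R * R)) (a b : R * R) : Prop :=
  exists (f : R -> R * R) (g : R * R -> R),
    [/\ homeomorphism `[0 : R, 1 : R] C f g, f 0 = a & f 1 = b].

Definition curve_interior (R : realType) (C : set (R * R)) (a b : R * R) :
  set (R * R) := C `\` [set a; b].

(* The injective family [C] of curves is the finite set of curves whose
   intersection graph is [e]; [a v] and [b v] are the endpoints of [C v]. *)
Definition contact_string_graph (R : realType) (V : finType) (e : rel V) :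
    Prop :=
  exists (C : V -> set (R * R)) (a b : V -> R * R),
    [/\ injective C,
        forall v, simple_curve (C v) (a v) (b v),
        forall u v, u != v ->
          curve_interior (C u) (a u) (b u) `&`
            curve_interior (C v) (a v) (b v) = set0 &
        forall u v, e u v <-> u != v /\ C u `&` C v !=set0].

(* Main.v *)
Require Import Defs.
From mathcomp Require Import all_boot all_order all_algebra.
From mathcomp Require Import all_classical all_reals topology normedtype.

(** Two curves meet only at a point that is an endpoint of at least one of them,
    and all the curves through a given point are pairwise adjacent. As the
    interiors are disjoint, each of the [2 n] endpoints lies in the interior of
    at most one curve, so some curve [v] has at most [2] of them in its
    interior. The curves through these points and through the two endpoints of
    [v] form at most [4] cliques, which cover the neighborhood of [v]. *)

(** Double counting: by disjointness the sizes of the [D v] add up to at most [#|T|], but sizes all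
    above [k] would exceed [k * #|V|]. *)
Lemma exists_card_le_of_disjoint {V T : finType} {k : nat} {D : V -> {set T}} :
  (0 < #|V|)%N -> (#|T| <= k * #|V|)%N ->
  (forall u v x, x \in D u -> x \in D v -> u = v) ->
  exists v, (#|D v| <= k)%N.
Proof.
move=> V_gt0 leT disjD; apply/existsP; apply: contraLR leT.
rewrite negb_exists -ltnNge => /forallP gtD.
have le_sum : (\sum_v #|D v| <= #|T|)%N.
  have -> : (\sum_v #|D v| = \sum_(x : T) \sum_(v | x \in D v) 1)%N.
    rewrite (exchange_big_dep xpredT) //=.
    by apply: eq_bigr => v _; rewrite sum1_card.
  rewrite -sum1_card; apply: leq_sum => x _.
  rewrite sum1_card; apply/card_le1P => u xDu v.
  apply/idP/eqP => [xDv|->//]; exact: (disjD v u x).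
apply: leq_trans le_sum.
apply: (@leq_trans (\sum_(v : V) k.+1)).
  by rewrite sum_nat_const mulnC ltn_pmul2l.
by apply: leq_sum => v _; rewrite ltnNge.
Qed.

(** The head [t] doubles as the [nth] default: indices past the end repeat [K t], which pads the
    family to exactly [k] cliques. *)
Lemma union_of_cliques_seq (V : finType) (T : Type) (e : rel V) (k : nat)
    (N : {set V}) (K : T -> {set V}) (t : T) (s : seq T) :
  (size s < k)%N -> (forall p, clique e (K p)) ->
  (forall u, u \in N <-> has (fun p => u \in K p) (t :: s)) ->
  union_of_cliques e k N.
Proof.
move=> lt_sk cliqueK NE; exists (fun i : 'I_k => K (nth t (t :: s) i)) => //.
apply/setP => u; apply/idP/bigcupP => [/NE/(has_nthP t)[i lti uK]|[i _ uK]].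
  by exists (Ordinal (leq_trans lti lt_sk)).
apply/NE; have [lti|lei] := ltnP i (size (t :: s)).
  by apply/(has_nthP t); exists i.
by move: uK; rewrite nth_default //= => ->.
Qed.

Theorem proposition4p3 (R : realType) (V : finType) (e : rel V)
    (V_gt0 : (0 < #|V|)%N) (e_contact : contact_string_graph R e) :
  exists v : V, union_of_cliques e 4 (neighborhood e v).
Proof.
have [C [a [b [_ _ disjC eE]]]] := e_contact.
pose I v := curve_interior (C v) (a v) (b v).
pose pt (x : V * bool) := if x.2 then a x.1 else b x.1.
pose D v := [set x | `[< I v (pt x) >]]%SET.
have [||v leD] := @exists_card_le_of_disjoint V _ 2 D V_gt0.
- by rewrite card_prod card_bool mulnC.
- move=> u v x; rewrite !inE => Iu Iv.
  have [//|/disjC disj_uv] := eqVneq u v.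
  by suff [] : @set0 (R * R) (pt x); rewrite -disj_uv.
exists v.
(* The conjunct [C v p] keeps [K p] inside the neighborhood of [v] for every point [p]. *)
pose K p := [set u | (u != v) && `[< C v p >] && `[< C u p >]]%SET.
apply: (@union_of_cliques_seq V _ e 4 _ K (a v) (b v :: map pt (enum (D v)))).
- by rewrite /= size_map -cardE.
- move=> p x y; rewrite !inE => /andP[_ /asboolP Cx] /andP[_ /asboolP Cy] xy.
  by apply/eE; split=> //; exists p.
move=> u; split=> [|/hasP[p _]]; last first.
  rewrite !inE => /andP[/andP[uv /asboolP Cv] /asboolP Cu].
  by apply/eE; rewrite eq_sym; split=> //; exists p.
rewrite inE => /eE[vu [p [Cvp Cup]]].
have uK : u \in K p by rewrite inE eq_sym vu /=; apply/andP; split; apply/asboolP.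
apply/hasP; exists p => //; rewrite !inE.
have [//|pa] := eqVneq p (a v); have [//|pb] := eqVneq p (b v).
have Ivp : I v p by split=> // -[] /eqP; apply/negP.
(* Here [p] is an endpoint of [C u], or else it would be interior to both curves. *)
have [x px] : exists x, p = pt x.
  apply/not_existsP => npt; suff [] : @set0 (R * R) p.
  rewrite -(disjC v u vu); split=> //; split=> // -[] pE.
    exact: (npt (u, true)).
  exact: (npt (u, false)).
by rewrite px map_f // mem_enum inE -px; apply/asboolP.
Qed.
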